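(* Let $\alpha,\alpha',\beta,\beta',\tau,\kappa>0$ be real numbers satisfying $$\kappa\log\Big(\frac{1}{\tau}-1\Big)>\log 2+1,\qquad 0<\tau<\tfrac13,\qquad 0<\kappa<1,$$ $$\frac{1}{\alpha}+\frac{1}{\alpha'}<1,\qquad \gamma:=1-\frac{1}{\beta}-\frac{1}{\beta'}>0.$$ Then for every integer $M>0$, every real $C>0$, every channel $W$ with input alphabet $\mathcal X$ and output alphabet $\mathcal Y$, and every probability distribution $p$ on $\mathcal X$ such that $$\beta\,\mathrm{E}_{p}\,W_x\Big\{y : \tfrac{W_x(y)}{W_p(y)}\le C\Big\}+\alpha'\beta'\frac{1}{C}\Big\lceil\frac{M}{\gamma}\Big\rceil<1,$$ there exists an identification code $\Phi$ for $W$ with $$\mu(\Phi)\le \alpha\beta\,\mathrm{E}_{p}\,W_x\Big\{y: \tfrac{W_x(y)}{W_p(y)}\le C\Big\},\qquad \lambda(\Phi)\le \kappa+\alpha'\beta'\frac{1}{C}\Big\lceil\frac{M}{\gamma}\Big\rceil,\qquad |\Phi|=\Big\lfloor\frac{e^{\tau M}}{Me}\Big\rfloor.$$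
   Context: A channel $W$ from a finite or countable set $\mathcal X$ to a finite or countable set $\mathcal Y$ is a map $x\mapsto W_x$ assigning to each $x\in\mathcal X$ a probability distribution $W_x$ on $\mathcal Y$. For a distribution $p$ on $\mathcal X$, $W_p(y):=\sum_x p(x)W_x(y)$, and $\frac{W_x}{W_p}(y):=W_x(y)/W_p(y)$. $\mathrm{E}_p$ denotes expectation over $x$ distributed according to $p$; for a set $A\subset\mathcal Y$, $W_x\{A\}=W_x(A)=\sum_{y\in A}W_x(y)$. An identification code for $W$ is a triple $\Phi=(N,\{Q_1,\dots,Q_N\},\{\mathcal D_1,\dots,\mathcal D_N\})$ where $N$ is a positive integer, $Q_1,\dots,Q_N$ are probability distributions on $\mathcal X$, and $\mathcal D_1,\dots,\mathcal D_N\subset\mathcal Y$ are subsets (not necessarily disjoint). Its size is $|\Phi|:=N$, and its error probabilities are $\mu(\Phi):=\max_i W_{Q_i}(\mathcal D_i^c)$ and $\lambda(\Phi):=\max_{i\ne j}W_{Q_j}(\mathcal D_i)$, where $\mathcal D_i^c$ is the complement of $\mathcal D_i$ in $\mathcal Y$.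
   Formalization: The code size N is allowed to be 0 (the empty code, with no error conditions), since ⌊e^{τM}/(Me)⌋ can be 0, for example when M = 1, where no code with positive N could have the stated size. *)

(* Defs.v *)
From HB Require Import structures.
From mathcomp Require Import all_boot all_order all_algebra.
From mathcomp Require Import all_classical all_reals.
From mathcomp Require Import ereal esum sequences exp.
Set Implicit Arguments. Unset Strict Implicit. Unset Printing Implicit Defensive.
Import Order.TTheory GRing.Theory Num.Theory.
Local Open Scope classical_set_scope.
Local Open Scope ring_scope.

Definition is_distr {R : realType} {T : countType} (p : T -> R) : Prop :=
  (forall x, 0 <= p x) /\ (\esum_(x in [set: T]) (p x)%:E = 1)%E.

Definition is_channel {R : realType} {X Y : countType} (W : X -> Y -> R) : Prop :=
  forall x, is_distr (W x).

(* W_p(y) = sum_x p(x) W_x(y)  (finite, as it lies in [0,1]) *)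
Definition outdist {R : realType} {X Y : countType} (W : X -> Y -> R) (p : X -> R)
  (y : Y) : R := fine (\esum_(x in [set: X]) (p x * W x y)%:E).

Definition outprob {R : realType} {X Y : countType} (W : X -> Y -> R) (p : X -> R)
  (A : set Y) : \bar R := \esum_(y in A) (outdist W p y)%:E.

Definition info_tail {R : realType} {X Y : countType} (W : X -> Y -> R) (p : X -> R)
  (C : R) : \bar R :=
  \esum_(x in [set: X])
     ((p x)%:E * \esum_(y in [set y | (W x y / outdist W p y <= C)%R]) (W x y)%:E)%E.

(* An identification code (N, (Q_i), (D_i)) with mu(Phi) <= mu0, lambda(Phi) <= lam0
   and |Phi| = N; max over indices is unfolded into "for all". *)
Definition is_id_code {R : realType} {X Y : countType} (W : X -> Y -> R) (N : nat)
  (Q : 'I_N -> X -> R) (D : 'I_N -> set Y) (mu0 lam0 : \bar R) : Prop :=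
  (forall i, is_distr (Q i)) /\
  (forall i, (outprob W (Q i) (~` D i) <= mu0)%E) /\
  (forall i j, i != j -> (outprob W (Q j) (D i) <= lam0)%E).

(* Main.v *)
Require Import Defs.
From HB Require Import structures.
From mathcomp Require Import all_boot all_order all_algebra.
From mathcomp Require Import all_classical all_reals.
From mathcomp Require Import ereal esum sequences exp.
From mathcomp Require Import lra ring.
Import Order.TTheory GRing.Theory Num.Theory.
Local Open Scope classical_set_scope.
Local Open Scope ring_scope.

(** Draw [n = ceil (M / gamma)] codewords independently from [p] and decode
    [x] on the set [D_x] where [W_x / W_p > C]. On average a codeword misses its
    own set with probability [e = info_tail W p C], and hits the set of another
    one with probability at most [1 / C]. Averaging (with [a], [a']) gives a
    draw for which the sums of both kinds of errors are controlled, and Markov's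
    inequality (with [b], [b']) leaves at least [n gamma >= M] codewords whose
    individual errors are controlled.

    Let [k = floor (tau M)] and [q = floor (M / k) > 1 / tau - 1], and arrange
    [k q <= M] good codewords in a [k x q] array. A function from ['I_k] to
    ['I_q] picks one codeword in each row; message [j] is sent by choosing
    uniformly among the [k] codewords picked by [f_j], and recognised on the
    union of their decoding sets. The part [kappa] of the second error comes
    from the rows where two messages agree, so one needs [N] functions that
    pairwise agree in at most [kappa k] rows. A greedy choice provides them,
    because a proportion at most [2 ^ k / q ^ (kappa k) < exp (- k)] of all
    functions agrees with a given one in more rows. *)

(** * Sums over countable sets *)

Section Esum.
Local Open Scope ereal_scope.
Context {R : realType}.

(** Finite partial sums only give [<=]; for [c > 0] the converse is that same inequality applied to
    [c^-1] and [c * f]. *)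
Lemma esumZl (T : choiceType) (I : set T) (c : R) (f : T -> \bar R) :
  (0 <= c)%R -> (forall i, 0 <= f i) ->
  \esum_(i in I) (c%:E * f i) = c%:E * \esum_(i in I) f i.
Proof.
have le (d : R) (g : T -> \bar R) : (0 <= d)%R -> (forall i, 0 <= g i) ->
    \esum_(i in I) (d%:E * g i) <= d%:E * \esum_(i in I) g i.
  move=> d0 g0; apply: ge_ereal_sup => _ [A [finA AI] <-].
  rewrite -ge0_mule_fsumr// lee_wpmul2l// ?lee_fin//.
  by apply: ereal_sup_ubound; exists A.
move=> c0 f0; apply/eqP; rewrite eq_le le//=.
have [->|cn0] := eqVneq c 0%R; first by rewrite mul0e esum_ge0// => i Ii; rewrite mul0e.
have cp : (0 < c)%R by rewrite lt_def cn0.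
rewrite -lee_pdivlMl//; apply: le_trans (le c^-1%R (fun i => c%:E * f i) _ _).
- by apply: le_esum => i _; rewrite muleA -EFinM mulVf// mul1e.
- by rewrite invr_ge0.
- by move=> i; rewrite mule_ge0// lee_fin.
Qed.

Lemma exchange_esum (T1 T2 : choiceType) (I : set T1) (J : set T2)
    (f : T1 -> T2 -> \bar R) : (forall i j, 0 <= f i j) ->
  \esum_(i in I) \esum_(j in J) f i j = \esum_(j in J) \esum_(i in I) f i j.
Proof.
move=> f0; rewrite !esum_esum//.
rewrite (reindex_esum (J `*` I) _ (fun x => (x.2, x.1)))//; split=> //=.
- by move=> [i j] /= [].
- by move=> [i1 j1] [i2 j2] /= _ _ [] -> ->.
- by move=> [i j] [Ii Jj] /=; exists (j, i).
Qed.

Lemma esum_subset (T : choiceType) (A B : set T) (f : T -> \bar R) :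
  (forall i, 0 <= f i) -> A `<=` B -> \esum_(i in A) f i <= \esum_(i in B) f i.
Proof.
move=> f0 AB; rewrite [leLHS]esum_mkcond [leRHS]esum_mkcond.
apply: le_esum => i _; case: ifPn => [|_]; last by case: ifP.
by rewrite inE => /AB iB; rewrite mem_set.
Qed.

End Esum.

(** * Iterated expectation *)

Section Expectation.
Local Open Scope ereal_scope.
Context {R : realType} {X : countType}.
Variable p : X -> R.
Hypothesis pP : is_distr p.

Let p0 x : 0 <= (p x)%:E. Proof. by rewrite lee_fin; case: pP. Qed.
Let p1 : \esum_(x in [set: X]) (p x)%:E = 1. Proof. by case: pP. Qed.

Definition expect (f : X -> \bar R) : \bar R :=
  \esum_(x in [set: X]) ((p x)%:E * f x).

Lemma expect_ge0 f : (forall x, 0 <= f x) -> 0 <= expect f.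
Proof. by move=> f0; apply: esum_ge0 => x _; rewrite mule_ge0. Qed.

Lemma le_expect f g : (forall x, f x <= g x) -> expect f <= expect g.
Proof. by move=> fg; apply: le_esum => x _; rewrite lee_wpmul2l. Qed.

Lemma expect_cst (c : \bar R) : 0 <= c -> expect (fun=> c) = c.
Proof.
have real_cst (r : R) : (0 <= r)%R -> expect (fun=> r%:E) = r%:E.
  move=> r0; rewrite /expect; under eq_esum do rewrite muleC.
  by rewrite esumZl// p1 mule1.
case: c => [r| |//] c0; first exact: real_cst.
(* For an infinite constant, monotonicity puts the expectation above every finite one. *)
apply/eqyP => r r0; rewrite -(real_cst r (ltW r0)).
by apply: le_expect => x; rewrite leey.
Qed.

Lemma expectZl (c : R) f : (0 <= c)%R -> (forall x, 0 <= f x) ->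
  expect (fun x => c%:E * f x) = c%:E * expect f.
Proof.
move=> c0 f0; rewrite /expect -esumZl// => [|x]; last by rewrite mule_ge0.
by apply: eq_esum => x _; rewrite muleCA.
Qed.

Lemma expect_sum (I : choiceType) (r : seq I) (P : pred I) (f : X -> I -> \bar R) :
  (forall x i, 0 <= f x i) ->
  expect (fun x => \sum_(i <- r | P i) f x i) =
  \sum_(i <- r | P i) expect (f^~ i).
Proof.
move=> f0; rewrite /expect -esum_sum => [|x i _ _]; last by rewrite mule_ge0.
by apply: eq_esum => x _; rewrite ge0_sume_distrr.
Qed.

Lemma expectD f g : (forall x, 0 <= f x) -> (forall x, 0 <= g x) ->
  expect (fun x => f x + g x) = expect f + expect g.
Proof.
move=> f0 g0; rewrite /expect -esumD => [|x _|x _]; try by rewrite mule_ge0.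
by apply: eq_esum => x _; rewrite ge0_muleDr.
Qed.

Lemma expect_eq0 f x : (forall x, 0 <= f x) -> expect f = 0 -> (0 < p x)%R -> f x = 0.
Proof.
move=> f0 E0 px; apply/eqP; rewrite eq_le f0 andbT -(@pmule_rle0 _ (p x)%:E)// -E0.
have pf0 y : 0 <= (p y)%:E * f y by rewrite mule_ge0.
by rewrite -[leLHS](@esum_set1 R X x (fun y => (p y)%:E * f y))// esum_subset.
Qed.

Lemma exchange_expect (f : X -> X -> \bar R) : (forall x y, 0 <= f x y) ->
  expect (fun x => expect (f x)) = expect (fun y => expect (f^~ y)).
Proof.
move=> f0; have g0 x y : 0 <= (p x)%:E * ((p y)%:E * f x y) by rewrite !mule_ge0.
transitivity (\esum_(x in [set: X]) \esum_(y in [set: X])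
    ((p x)%:E * ((p y)%:E * f x y))).
  apply: eq_esum => x _; rewrite esumZl//; first by case: pP.
  by move=> y; rewrite mule_ge0.
rewrite exchange_esum//; apply: eq_esum => y _.
rewrite -esumZl//; first by apply: eq_esum => x _; rewrite muleCA.
- by case: pP.
- by move=> x; rewrite mule_ge0.
Qed.

(** First-moment method, by contraposition: if [f >= 1] wherever [p] is positive, then
    [expect f >= 1]. Keeping [0 < p x] makes [expect_eq0] applicable to the point found. *)
Lemma expect_lt1_ex f : expect f < 1 -> exists2 x, (0 < p x)%R & f x < 1.
Proof.
apply: contraPP => /forall2NP nf; apply/negP; rewrite -leNgt -p1.
apply: le_esum => x _; have [/negP|/negP] := nf x.
  rewrite -leNgt => px0; rewrite (_ : p x = 0%R) ?mul0e//.
  by apply/eqP; rewrite eq_le px0 /=; case: pP => ->.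
by rewrite -leNgt => fx1; rewrite -[leLHS]mule1 lee_wpmul2l.
Qed.

(** Expectation over [n] independent draws, taken one draw at a time so that no product distribution
    on tuples has to be handled. *)
Fixpoint iter_expect (n : nat) (F : seq X -> \bar R) : \bar R :=
  if n is m.+1 then expect (fun x => iter_expect m (fun s => F (x :: s)))
  else F [::].

Lemma iter_expect_ge0 n F : (forall s, 0 <= F s) -> 0 <= iter_expect n F.
Proof. by elim: n F => [|n IH] F F0 //=; apply: expect_ge0 => x; apply: IH. Qed.

Lemma iter_expectZl n (c : R) F : (0 <= c)%R -> (forall s, 0 <= F s) ->
  iter_expect n (fun s => c%:E * F s) = c%:E * iter_expect n F.
Proof.
move=> c0; elim: n F => [|n IH] F F0 //=.
rewrite -expectZl//; last by move=> x; apply: iter_expect_ge0.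
by congr expect; apply/funext => x; rewrite IH.
Qed.

Lemma iter_expect_sum n (I : choiceType) (r : seq I) (P : pred I)
    (F : seq X -> I -> \bar R) : (forall s i, 0 <= F s i) ->
  iter_expect n (fun s => \sum_(i <- r | P i) F s i) =
  \sum_(i <- r | P i) iter_expect n (F^~ i).
Proof.
elim: n F => [|n IH] F F0 //=.
rewrite -expect_sum//; last by move=> x i; apply: iter_expect_ge0.
by congr expect; apply/funext => x; rewrite IH.
Qed.

Lemma iter_expectD n F G : (forall s, 0 <= F s) -> (forall s, 0 <= G s) ->
  iter_expect n (fun s => F s + G s) = iter_expect n F + iter_expect n G.
Proof.
elim: n F G => [|n IH] F G F0 G0 //=.
rewrite -expectD; try by move=> x; apply: iter_expect_ge0.
by congr expect; apply/funext => x; rewrite IH.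
Qed.

Lemma iter_expect_cst n (c : \bar R) : 0 <= c -> iter_expect n (fun=> c) = c.
Proof. by move=> c0; elim: n => [//|n /= ->]; rewrite expect_cst. Qed.

Lemma iter_expect_nth x0 n i (f : X -> \bar R) : (i < n)%N -> (forall x, 0 <= f x) ->
  iter_expect n (fun s => f (nth x0 s i)) = expect f.
Proof.
move=> + f0; elim: n i => [|n IH] [|i]//= lin.
  by congr expect; apply/funext => x; rewrite iter_expect_cst.
by rewrite IH// expect_cst// expect_ge0.
Qed.

(** Independence of two distinct draws: the recursion peels off draws until it meets one of the two
    positions, and the other is then a single draw. *)
Lemma iter_expect_nth2 x0 n i j (f : X -> X -> \bar R) :
  (i < n)%N -> (j < n)%N -> i != j -> (forall x y, 0 <= f x y) ->
  iter_expect n (fun s => f (nth x0 s i) (nth x0 s j)) =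
  expect (fun x => expect (f x)).
Proof.
move=> + + + f0; elim: n i j => [|n IH] [|i] [|j]//= lin ljn ij.
- by congr expect; apply/funext => x; rewrite iter_expect_nth.
(* Position [j] is met first, so the two expectations come in the opposite order. *)
- rewrite exchange_expect//; congr expect; apply/funext => x.
  by rewrite (@iter_expect_nth _ _ _ (f^~ x)).
- by rewrite IH// expect_cst// expect_ge0// => x; apply: expect_ge0.
Qed.

Lemma iter_expect_lt1_ex n F : iter_expect n F < 1 ->
  exists2 s, size s = n /\ (forall x, x \in s -> 0 < p x)%R & F s < 1.
Proof.
elim: n F => [|n IH] F /=; first by exists [::].
move=> /expect_lt1_ex[x px0 /IH[s [sn sp] Fs]]; exists (x :: s) => //=.
by split=> [|y]; rewrite ?sn// inE => /orP[/eqP->//|/sp].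
Qed.

End Expectation.

(** * Functions with few agreements *)

(** The neighbourhoods of the [N] points already chosen cover at most [N * B] elements, so a further
    point can be taken outside all of them. *)
Lemma greedy_packing (T : finType) (r : rel T) (B N : nat) :
  symmetric r -> (forall x, #|[pred y | r x y]| <= B)%N -> (N * B < #|T|)%N ->
  exists f : 'I_N -> T, forall i j, i != j -> ~~ r (f i) (f j).
Proof.
move=> rS rB; elim: N => [|N IH] NB.
  by have /card_gt0P[x _] := NB; exists (fun=> x); case.
have [f fP] : exists f : 'I_N -> T, forall i j, i != j -> ~~ r (f i) (f j).
  by apply: IH; apply: leq_ltn_trans NB; rewrite mulSn leq_addl.
pose U := [set y | [exists i, r (f i) y]]%SET.
have cU : (#|U| <= N * B)%N.
  have -> : U = (\bigcup_i [set y | r (f i) y])%SET.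
    apply/setP => y; rewrite inE; apply/existsP/finset.bigcupP => [[i ri]|[i _]].
      by exists i => //; rewrite inE.
    by rewrite inE => ri; exists i.
  apply: (@leq_trans (\sum_(i < N) B)).
    apply: (big_ind2 (fun (A : {set T}) m => #|A| <= m)%N); first by rewrite cards0.
      by move=> A m A' m' Am Am'; rewrite (leq_trans (leq_card_setU _ _))// leq_add.
    by move=> i _; rewrite cardsE; apply: rB.
  by rewrite sum_nat_const card_ord.
have /subsetPn [x _ xU] : ~~ ([set: T]%SET \subset U).
  apply/negP => /subset_leq_card; rewrite cardsT leqNgt => /negP; apply.
  by apply: leq_ltn_trans NB; rewrite (leq_trans cU)// leq_mul2r leqnSn orbT.
have xn i : ~~ r (f i) x.
  by move: xU; rewrite inE => /existsPn.
(* The new point takes the last index; [unlift] sends every other index back to the earlier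
   family. *)
exists (fun i => oapp f x (unlift ord_max i)) => i j.
case: unliftP => [i' ->|->]; case: unliftP => [j' ->|->] //=.
- by rewrite (inj_eq lift_inj) => /fP.
- by rewrite rS.
- by rewrite eqxx.
Qed.

Definition agreement {k q : nat} (f g : {ffun 'I_k -> 'I_q}) : nat :=
  #|[pred i | f i == g i]|.

(* The generating function [\sum_g q ^ agreement f g = (2 q - 1) ^ k]. *)
Lemma sum_expn_agreement (k q : nat) (f : {ffun 'I_k -> 'I_q}) :
  (\sum_g q ^ agreement f g <= (2 * q) ^ k)%N.
Proof.
(* The weight is a product over rows, [q] for agreement and 1 otherwise, so the sum over all [g]
   factors. *)
have -> : (\sum_(g : {ffun 'I_k -> 'I_q}) q ^ agreement f g =
    \prod_(i < k) \sum_(j < q) (if f i == j then q else 1))%N.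
  rewrite bigA_distr_bigA; apply: eq_bigr => g _.
  by rewrite -big_mkcond prod_nat_const.
(* Each factor is [q] for the agreeing value plus [q - 1] for the others, rounded up to [2 * q]. *)
apply: (@leq_trans (\prod_(i < k) (2 * q))); last by rewrite prod_nat_const card_ord.
apply: leq_prod => i _; rewrite (bigD1 (f i))//= eqxx mul2n -addnn leq_add2l.
rewrite -[leqRHS]card_ord -sum1_card [leqRHS](bigD1 (f i))//=.
apply: (@leq_trans (\sum_(j < q | j != f i) 1)); last exact: leq_addl.
by apply: leq_sum => j; rewrite eq_sym => /negbTE ->.
Qed.

(** Chernoff-type bound: every [g] in the ball contributes at least [q ^ d] to the generating
    function. *)
Lemma card_agreement_ball (R : realType) (k q : nat) (f : {ffun 'I_k -> 'I_q}) (d : R) :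
  (0 < q)%N ->
  (#|[pred g | d < (agreement f g)%:R]|)%:R * (q%:R `^ d) <= (2 * q)%:R ^+ k :> R.
Proof.
move=> q0; rewrite -natrX.
apply: le_trans (_ : (\sum_g q ^ agreement f g)%:R <= _); last first.
  by rewrite ler_nat sum_expn_agreement.
rewrite natr_sum (bigID [pred g | d < (agreement f g)%:R])/=.
rewrite -[leLHS]addr0 lerD//; last by apply: sumr_ge0.
rewrite mulr_natl -sumr_const; apply: ler_sum => g /= dg.
by rewrite natrX -powR_mulrn// ler_powR ?ler1n//; apply: ltW.
Qed.

Lemma agreement_code (R : realType) (k q N : nat) (kappa : R) :
  (0 < k)%N -> (0 < q)%N -> ln 2 + 1 < kappa * ln q%:R -> N%:R <= expR k%:R :> R ->
  exists f : 'I_N -> {ffun 'I_k -> 'I_q},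
    forall i j, i != j -> (agreement (f i) (f j))%:R <= kappa * k%:R.
Proof.
move=> k0 q0 hk hN; pose r (f g : {ffun 'I_k -> 'I_q}) := kappa * k%:R < (agreement f g)%:R.
have rS : symmetric r.
  by move=> f g; rewrite /r /agreement; congr (_ < _%:R); apply: eq_card => i; rewrite !inE eq_sym.
(* All balls have the same size by symmetry; choosing a largest one avoids proving it. *)
have [fr ball] : exists fr, forall f, (#|[pred g | r f g]| <= #|[pred g | r fr g]|)%N.
  pose f0 : {ffun 'I_k -> 'I_q} := [ffun=> Ordinal q0].
  exists [arg max_(f > f0) #|[pred g | r f g]|]%N => f.
  by case: arg_maxnP => // g _; apply.
have qR : 0 < q%:R :> R by rewrite ltr0n.
have [|f fP] := @greedy_packing _ r _ N rS ball.
  rewrite card_ffun !card_ord -(ltr_nat R) natrM.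
  have := @card_agreement_ball R _ _ fr (kappa * k%:R) q0.
  have -> : q%:R `^ (kappa * k%:R) = expR (k%:R * (kappa * ln q%:R)) :> R.
    by rewrite /powR gt_eqF// ; congr expR; ring.
  set E := expR _; set b := _%:R => hb.
  have E0 : 0 < E by exact: expR_gt0.
  (* This is the hypothesis [ln 2 + 1 < kappa * ln q] multiplied by [k] and exponentiated. *)
  have lt : 2 ^+ k * expR k%:R < E :> R.
    rewrite -[X in X ^+ k](@lnK R 2) ?posrE// -expRM_natl -expRD ltr_expR.
    by rewrite -[X in _ + X]mulr1 -mulrDr ltr_pM2l// ltr0n.
  (* The packing condition multiplied by [E]: [N b E <= e^k (2 q)^k < E q^k]. *)
  rewrite -(ltr_pM2r E0) -mulrA.
  apply: (@le_lt_trans _ _ (expR k%:R * (2 * q)%:R ^+ k)).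
    by apply: ler_pM => //; rewrite mulr_ge0// ltW.
  rewrite natrM exprMn mulrCA mulrA natrX [ltRHS]mulrC ltr_pM2r ?exprn_gt0//.
by exists f => i j /fP; rewrite /r -leNgt.
Qed.

(** Markov's inequality for the uniform distribution on ['I_n]. Counting strict excesses keeps it
    true at [t = 0], where every [u i] vanishes. *)
Lemma markov_card (R : realType) (n : nat) (u : 'I_n -> R) (t b : R) :
  (forall i, 0 <= u i) -> 0 <= t -> 0 < b -> \sum_i u i <= n%:R * t ->
  #|[pred i | b * t < u i]|%:R <= n%:R / b.
Proof.
move=> u0 t0 b0 hu; rewrite ler_pdivlMr//.
have [t00|tn0] := eqVneq t 0.
  move: hu; rewrite t00 mulr0 => hu.
  have /eqP : \sum_i u i = 0 by apply/eqP; rewrite eq_le hu sumr_ge0.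
  rewrite psumr_eq0// => /allP uz.
  rewrite (_ : #|_| = 0%N) ?mul0r ?ler0n//; apply: eq_card0 => i.
  by rewrite !inE mulr0 (eqP (uz i _)) ?ltxx// mem_index_enum.
have tp : 0 < t by rewrite lt_def tn0.
rewrite -(ler_pM2r tp) (le_trans _ hu)// -mulrA mulr_natl -sumr_const.
rewrite [leRHS](bigID [pred i | b * t < u i])/= -[leLHS]addr0 lerD ?sumr_ge0//.
by apply: ler_sum => i; rewrite inE => /ltW.
Qed.

(** * Random coding *)

Section Probability.
Context {R : realType} {Y : countType}.
Variable q : Y -> R.
Hypothesis qP : is_distr q.
Implicit Types A : set Y.

Let q0 y : (0 <= (q y)%:E)%E. Proof. by rewrite lee_fin; case: qP. Qed.

Definition prob A : R := fine (\esum_(y in A) (q y)%:E).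

Lemma esum_distr_le1 A : (\esum_(y in A) (q y)%:E <= 1)%E.
Proof. by case: qP => _ <-; apply: esum_subset. Qed.

Lemma probE A : (prob A)%:E = (\esum_(y in A) (q y)%:E)%E.
Proof.
rewrite fineK// ge0_fin_numE; last by apply: esum_ge0.
by rewrite (le_lt_trans (esum_distr_le1 A))// ltry.
Qed.

Lemma prob_ge0 A : 0 <= prob A.
Proof. by rewrite -lee_fin probE esum_ge0. Qed.

Lemma prob_le1 A : prob A <= 1.
Proof. by rewrite -lee_fin probE esum_distr_le1. Qed.

Lemma distr_le1 y : q y <= 1.
Proof.
by rewrite -lee_fin -(@esum_set1 _ _ y (fun y => (q y)%:E))// esum_distr_le1.
Qed.

Lemma le_prob A B : A `<=` B -> prob A <= prob B.
Proof. by move=> AB; rewrite -lee_fin !probE esum_subset. Qed.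

Lemma prob_union_bound (I : finType) (P : pred I) (D : I -> set Y) A :
  (forall y, A y -> exists2 i, P i & D i y) ->
  prob A <= \sum_(i | P i) prob (D i).
Proof.
move=> AD; rewrite -lee_fin probE -sumEFin.
under eq_bigr do rewrite probE esum_mkcond.
rewrite esum_mkcond -esum_sum => [|y i _ _]; last by case: ifP.
apply: le_esum => y _; case: ifPn => [|_]; last first.
  by apply: sume_ge0 => i _; case: ifP.
rewrite inE => /AD[i Pi Diy]; rewrite (bigD1 i)//= mem_set//.
by rewrite leeDl//; apply: sume_ge0 => j _; case: ifP.
Qed.

End Probability.

Section RandomCoding.
Context {R : realType} {X Y : countType}.
Variables (W : X -> Y -> R) (p : X -> R) (C : R).
Hypotheses (WP : is_channel W) (pP : is_distr p) (C0 : 0 < C).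

Let p0 x : 0 <= p x. Proof. by case: pP. Qed.
Let W0 x y : 0 <= W x y. Proof. by case: (WP x). Qed.

Lemma outdistE y : (outdist W p y)%:E = (\esum_(x in [set: X]) (p x * W x y)%:E)%E.
Proof.
rewrite fineK// ge0_fin_numE; last by apply: esum_ge0 => x _; rewrite lee_fin mulr_ge0.
apply: (@le_lt_trans _ _ 1%E); last exact: ltry.
case: pP => _ <-; apply: le_esum => x _.
by rewrite lee_fin ler_piMr// distr_le1.
Qed.

Lemma outdist_ge0 y : 0 <= outdist W p y.
Proof. by rewrite -lee_fin outdistE esum_ge0// => x _; rewrite lee_fin mulr_ge0. Qed.

Lemma expect_prob (A : set Y) : expect p (fun x => (prob (W x) A)%:E) = outprob W p A.
Proof.
rewrite /outprob; under [RHS]eq_esum do rewrite outdistE.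
rewrite exchange_esum => [|x y]; last by rewrite lee_fin mulr_ge0.
by apply: eq_esum => x _; rewrite probE// -esumZl// => y; rewrite lee_fin.
Qed.

Definition decoding_set (x : X) : set Y := [set y | C < W x y / outdist W p y].

Lemma info_tailE :
  info_tail W p C = expect p (fun x => (prob (W x) (~` decoding_set x))%:E).
Proof.
apply: eq_esum => x _; rewrite probE//; congr (_ * esum _ _)%E.
by apply/seteqP; split=> y /=; rewrite leNgt => /negP.
Qed.

Lemma info_tail_fin_num : info_tail W p C \is a fin_num.
Proof.
have f0 x : (0 <= (prob (W x) (~` decoding_set x))%:E)%E by rewrite lee_fin prob_ge0.
rewrite info_tailE ge0_fin_numE ?expect_ge0//.
apply: (@le_lt_trans _ _ 1%E); last exact: ltry.
rewrite -(@expect_cst _ _ _ pP 1%E)//; apply: le_expect => // x.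
by rewrite lee_fin prob_le1.
Qed.

(** Change of measure: on [decoding_set x] the output distribution is below [W x / C], and [W x] has
    total mass 1. *)
Lemma outprob_decoding_set x : (outprob W p (decoding_set x) <= C^-1%:E)%E.
Proof.
apply: (@le_trans _ _ (\esum_(y in decoding_set x) (C^-1%:E * (W x y)%:E))%E).
  apply: le_esum => y; rewrite /decoding_set/= => Cy.
  (* Division by zero gives 0, which does not exceed [C], so [decoding_set x] contains only points
     of positive output probability. *)
  have o0 : 0 < outdist W p y.
    rewrite lt_def outdist_ge0 andbT; apply/eqP => o0.
    by move: Cy; rewrite o0 invr0 mulr0 ltNge ltW.
  by rewrite lee_fin -ler_pdivrMl ?invr_gt0// invrK ltW// -ltr_pdivlMr.
rewrite esumZl ?invr_ge0 ?(ltW C0)// => [|y]; last by rewrite lee_fin.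
by rewrite -[leRHS]mule1 lee_wpmul2l ?lee_fin ?invr_ge0 ?(ltW C0)// esum_distr_le1.
Qed.

(** Both error sums, each divided by its target, have means at most [a^-1] and [a'^-1]. The mean of
    their total is below 1, so some draw keeps both ratios below 1. *)
Lemma random_code (n : nat) (a a' : R) :
  (0 < n)%N -> 0 < a -> 0 < a' -> a^-1 + a'^-1 < 1 ->
  exists s : 'I_n -> X,
    \sum_i prob (W (s i)) (~` decoding_set (s i)) <=
      n%:R * (a * fine (info_tail W p C)) /\
    \sum_i \sum_(l | l != i) prob (W (s i)) (decoding_set (s l)) <=
      n%:R * (a' * (n%:R / C)).
Proof.
move=> n0 a0 a'0 aa'.
have nR : 0 < n%:R :> R by rewrite ltr0n.
set e := fine _.
have eE : info_tail W p C = e%:E by rewrite fineK// info_tail_fin_num.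
(* A default value for [nth]; it exists because [p] has mass 1. *)
have [x0 _ _] : exists2 x, 0 < p x & (0 < 1 :> \bar R)%E.
  by apply: (expect_lt1_ex _ pP (fun=> 0%E)); rewrite expect_cst.
have u0 x : 0 <= prob (W x) (~` decoding_set x) by exact: prob_ge0.
have v0 x y : 0 <= prob (W x) (decoding_set y) by exact: prob_ge0.
have e0 : 0 <= e by rewrite -lee_fin -eE info_tailE expect_ge0.
(* Inverses of the two target bounds. If [e = 0] then [c1 = 0], and the first bound needs a separate
   argument below. *)
pose c1 := (n%:R * (a * e))^-1; pose c2 := (n%:R * (a' * (n%:R / C)))^-1.
have c10 : 0 <= c1 by rewrite invr_ge0 !mulr_ge0// ltW.
have c20 : 0 < c2 by rewrite invr_gt0 !mulr_gt0// invr_gt0.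
pose U (s : seq X) := (\sum_(i < n) (prob (W (nth x0 s i)) (~` decoding_set (nth x0 s i)))%:E)%E.
pose V (s : seq X) := (\sum_(i < n) \sum_(l < n | l != i)
  (prob (W (nth x0 s i)) (decoding_set (nth x0 s l)))%:E)%E.
have U0 s : (0 <= U s)%E by apply: sume_ge0 => i _; rewrite lee_fin.
have V0 s : (0 <= V s)%E by apply: sume_ge0 => i _; apply: sume_ge0 => l _; rewrite lee_fin.
have EU : iter_expect p n U = (n%:R * e)%:E.
  rewrite iter_expect_sum//; try by move=> *; rewrite lee_fin.
  under eq_bigr => i _ do
    rewrite (@iter_expect_nth _ _ _ pP x0 n i (fun x => (prob (W x) (~` decoding_set x))%:E))// -info_tailE eE.
  by rewrite sumEFin sumr_const card_ord mulr_natl.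
have EV : (iter_expect p n V <= (n%:R * (n%:R / C))%:E)%E.
  rewrite iter_expect_sum//; last by move=> s i; apply: sume_ge0 => l _; rewrite lee_fin.
  rewrite mulr_natl -[n in _ *+ n]card_ord -sumr_const -sumEFin.
  apply: lee_sum => i _.
  rewrite iter_expect_sum//; try by move=> *; rewrite lee_fin.
  apply: (@le_trans _ _ (\sum_(l < n | l != i) C^-1%:E)%E).
    apply: lee_sum => l li.
    rewrite (@iter_expect_nth2 _ _ _ pP x0 n i l (fun x y => (prob (W x) (decoding_set y))%:E)) 1?eq_sym//.
    (* Averaging first over the transmitted codeword, with the decoding set fixed, produces the
       output distribution. *)
    rewrite exchange_expect// -(@expect_cst _ _ _ pP (C^-1)%:E) ?lee_fin ?invr_ge0 ?(ltW C0)//.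
    by apply: le_expect => // y; rewrite expect_prob outprob_decoding_set.
  rewrite sumEFin lee_fin mulr_natl -[n in leRHS]card_ord -sumr_const.
  by rewrite [leRHS](bigD1 i)//= lerDr invr_ge0 ltW.
have : (iter_expect p n (fun s => c1%:E * U s + c2%:E * V s) < 1)%E.
  rewrite iter_expectD//; try by move=> s; rewrite mule_ge0// lee_fin// ltW.
  rewrite !iter_expectZl ?(ltW c20)//.
  apply: (@le_lt_trans _ _ (a^-1 + a'^-1)%:E); last by rewrite lte_fin.
  rewrite EFinD leeD//.
    rewrite EU -EFinM lee_fin /c1; have [->|en0] := eqVneq e 0.
      by rewrite !mulr0 invr_ge0 ltW.
    have ep : 0 < e by rewrite lt_def en0.
    by rewrite le_eqVlt; apply/orP; left; apply/eqP; field; rewrite !gt_eqF.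
  apply: (@le_trans _ _ (c2%:E * (n%:R * (n%:R / C))%:E)%E).
    by rewrite lee_wpmul2l// lee_fin ltW.
  rewrite -EFinM lee_fin /c2 le_eqVlt; apply/orP; left; apply/eqP; field.
  by rewrite !gt_eqF.
case/(iter_expect_lt1_ex _ pP) => s [sn sp]; rewrite /U /V.
under [X in (_ + _ * X)%E]eq_bigr do rewrite sumEFin.
rewrite !sumEFin -!EFinM -EFinD lte_fin => F1.
exists (fun i => nth x0 s i).
set u := (X in X <= _ /\ _); set v := (X in _ /\ X <= _).
have u_ge0 : 0 <= u by apply: sumr_ge0.
have v_ge0 : 0 <= v by apply: sumr_ge0 => i _; apply: sumr_ge0.
rewrite -/u -/v in F1; split.
(* With mean zero, the miss probability vanishes at every point of positive [p], hence at all drawn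
   codewords. *)
- have [ez|en0] := eqVneq e 0.
    rewrite ez !mulr0 /u big1// => i _; apply/eqP; rewrite -eqe; apply/eqP.
    apply: (@expect_eq0 _ _ _ pP (fun x => (prob (W x) (~` decoding_set x))%:E)) => //.
      by rewrite -info_tailE eE ez.
    by rewrite sp// mem_nth// sn.
  have ep : 0 < e by rewrite lt_def en0.
  have : c1 * u < 1 by apply: le_lt_trans F1; rewrite lerDl mulr_ge0// ltW.
  by rewrite ltr_pdivrMl ?mulr_gt0// mulr1 => /ltW.
- have : c2 * v < 1 by apply: le_lt_trans F1; rewrite lerDr mulr_ge0.
  by rewrite ltr_pdivrMl ?mulr_gt0 ?invr_gt0// mulr1 => /ltW.
Qed.

End RandomCoding.

(** * Identification codes *)

Section Identification.
Context {R : realType} {X Y : countType}.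
Variable W : X -> Y -> R.
Hypothesis WP : is_channel W.

(** Uniform over the indices: a repeated codeword is weighted by its multiplicity. *)
Definition uniform_on {k : nat} (z : 'I_k -> X) (x : X) : R :=
  k%:R^-1 * \sum_r (z r == x)%:R.

Lemma esum_uniform_on k (z : 'I_k -> X) (g : X -> R) : (forall x, 0 <= g x) ->
  (\esum_(x in [set: X]) (uniform_on z x * g x)%:E =
  (k%:R^-1 * \sum_r g (z r))%:E)%E.
Proof.
move=> g0; rewrite mulr_sumr -sumEFin.
transitivity (\esum_(x in [set: X]) \sum_(r < k)
    (if x \in [set z r] then (k%:R^-1 * g x)%:E else 0))%E.
  apply: eq_esum => x _; rewrite /uniform_on -mulrA mulr_suml mulr_sumr -sumEFin.
  apply: eq_bigr => r _; case: ifPn => [/set_mem ->|/negP xz]; first by rewrite eqxx mul1r.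
  rewrite (_ : (z r == x) = false) ?mul0r ?mulr0//; apply/eqP => zx.
  by apply: xz; rewrite zx inE.
have kg0 x : (0 <= (k%:R^-1 * g x)%:E)%E by rewrite lee_fin mulr_ge0// invr_ge0.
rewrite esum_sum => [|x r _ _]; last by case: ifP.
by apply: eq_bigr => r _; rewrite -esum_mkcond esum_set1.
Qed.

Lemma uniform_on_distr k (z : 'I_k -> X) : (0 < k)%N -> is_distr (uniform_on z).
Proof.
move=> k0; split=> [x|]; first by rewrite mulr_ge0 ?invr_ge0// sumr_ge0.
under eq_esum do rewrite -[uniform_on z _]mulr1.
rewrite (@esum_uniform_on k z (fun=> 1))// sumr_const card_ord mulVf//.
by rewrite pnatr_eq0 -lt0n.
Qed.

Lemma outprob_uniform_on k (z : 'I_k -> X) (A : set Y) :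
  outprob W (uniform_on z) A = (k%:R^-1 * \sum_r prob (W (z r)) A)%:E.
Proof.
have W0 x y : 0 <= W x y by case: (WP x).
rewrite /outprob EFinM -sumEFin; under [in RHS]eq_bigr do rewrite probE//.
rewrite -esum_sum => [|y r _ _]; last by rewrite lee_fin.
rewrite -esumZl ?invr_ge0// => [|y]; last by apply: sume_ge0 => r _; rewrite lee_fin.
apply: eq_esum => y _.
by rewrite /outdist (@esum_uniform_on k z (W^~ y))// sumEFin -EFinM.
Qed.

(* Agreement between [f i] and [f j] is the only overlap of the two codeword
   lists, since [phi] is injective; [s] itself may repeat codewords. *)
Lemma id_code_of_agreement_code (n k q N : nat) (s : 'I_n -> X) (D : X -> set Y)
    (phi : 'I_k * 'I_q -> 'I_n) (f : 'I_N -> {ffun 'I_k -> 'I_q}) (mu K kappa : R) :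
  (0 < k)%N -> injective phi ->
  (forall t, prob (W (s (phi t))) (~` D (s (phi t))) <= mu) ->
  (forall t, \sum_(l | l != phi t) prob (W (s (phi t))) (D (s l)) <= K) ->
  (forall i j, i != j -> (agreement (f i) (f j))%:R <= kappa * k%:R) ->
  is_id_code W (fun j => uniform_on (fun r => s (phi (r, f j r))))
    (fun i => [set y | exists r, D (s (phi (r, f i r))) y]) mu%:E (kappa + K)%:E.
Proof.
move=> k0 phi_inj hmu hK hf; have kR : 0 < k%:R :> R by rewrite ltr0n.
split; [|split] => [i|i|i j ij]; first exact: uniform_on_distr.
  rewrite outprob_uniform_on lee_fin ler_pdivrMl// mulr_natl -[k in leRHS]card_ord -sumr_const.
  apply: ler_sum => r _; apply: le_trans (hmu (r, f i r)).
  by apply: le_prob => // y Dy Dr; apply: Dy; exists r.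
rewrite outprob_uniform_on lee_fin ler_pdivrMl// mulrDr [k%:R * kappa]mulrC.
(* A row where the messages agree costs at most 1; any other row costs at most [K]. *)
apply: (@le_trans _ _ (\sum_(r < k) ((f i r == f j r)%:R + K))).
  apply: ler_sum => r _; have K0 : 0 <= K.
    by apply: le_trans (hK (r, f j r)); apply: sumr_ge0 => l _; apply: prob_ge0.
  have [fr|fr] := eqVneq (f i r) (f j r).
    by rewrite (le_trans (prob_le1 _ (WP _) _))// lerDl.
  rewrite add0r (le_trans _ (hK (r, f j r)))//.
  (* The codeword sent in row [r] is not in the list of message [i]: equal positions would force
     [r' = r] and agreement there. *)
  apply: (prob_union_bound _ (WP _)) => y [r' Dy]; exists (phi (r', f i r')) => //.
  by apply/eqP => /phi_inj[rr']; rewrite rr' => /eqP; rewrite (negbTE fr).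
rewrite big_split/= sumr_const card_ord -[K *+ k]mulr_natl lerD2r.
by rewrite -natr_sum (le_trans _ (hf _ _ ij))// ler_nat /agreement -sum1_card [leqRHS]big_mkcond.
Qed.

End Identification.

(** * Expurgation and choice of parameters *)

Lemma injection_into (T I : finType) (G : {set I}) : (#|T| <= #|G|)%N ->
  exists2 phi : T -> I, injective phi & forall t, phi t \in G.
Proof.
move=> TG; exists (fun t => enum_val (widen_ord TG (enum_rank t))) => [t t'|t].
  by move/enum_val_inj/(congr1 val) => /= /val_inj/enum_rank_inj.
exact: enum_valP.
Qed.

Theorem theorem1 (R : realType) (a a' b b' tau kappa : R) :
  0 < a -> 0 < a' -> 0 < b -> 0 < b' -> 0 < tau -> 0 < kappa ->
  kappa * ln (tau^-1 - 1) > ln 2 + 1 ->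
  tau < 3^-1 -> kappa < 1 ->
  a^-1 + a'^-1 < 1 ->
  0 < 1 - b^-1 - b'^-1 ->
  forall (M : nat) (C : R) (X Y : countType) (W : X -> Y -> R) (p : X -> R),
  (0 < M)%N -> 0 < C -> is_channel W -> is_distr p ->
  let gamma := 1 - b^-1 - b'^-1 in
  let K := (a' * b' / C * (Num.ceil (M%:R / gamma))%:~R) in
  (b%:E * info_tail W p C + K%:E < 1)%E ->
  exists (N : nat) (Q : 'I_N -> X -> R) (D : 'I_N -> set Y),
    is_id_code W Q D ((a * b)%:E * info_tail W p C)%E (kappa + K)%:E /\
    (N%:Z = Num.floor (expR (tau * M%:R) / (M%:R * expR 1)))%R.
Proof.
move=> a0 a'0 b0 b'0 tau0 kappa0 hkappa tau3 _ haa' hbb' M C X Y W p M0 C0 WP pP gamma K _.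
have MR : 0 < M%:R :> R by rewrite ltr0n.
have ex0 : 0 < expR (tau * M%:R) / (M%:R * expR 1) by rewrite divr_gt0 ?mulr_gt0 ?expR_gt0.
set N := Num.truncn (expR (tau * M%:R) / (M%:R * expR 1)).
have NE : N%:Z = Num.floor (expR (tau * M%:R) / (M%:R * expR 1)).
  by rewrite /N truncn_floor ltW// gez0_abs// floor_ge0 ltW.
have /andP[Nle _] := truncn_itv (ltW ex0); rewrite -/N in Nle.
(* For [N = 0] the empty code satisfies every condition vacuously. *)
have [N0|Npos] := posnP N.
  exists N, (fun=> p), (fun=> set0); split=> //.
  by split; [|split] => i; have := ltn_ord i; rewrite {2}N0.
(* From [1 <= N] one gets [e <= N M e <= exp (tau M)]; this makes [k] positive. *)
have tauM1 : 1 <= tau * M%:R.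
  rewrite -ler_expR; move: Nle; rewrite ler_pdivlMr ?mulr_gt0 ?expR_gt0// mulrA.
  apply: le_trans; rewrite ler_peMl ?expR_ge0// -natrM ler1n muln_gt0 Npos M0 //.
pose k := Num.truncn (tau * M%:R).
have /andP[kle klt] := truncn_itv (le_trans ler01 tauM1); rewrite -/k in kle klt.
have k0 : (0 < k)%N by rewrite -ltnS -(ltr_nat R) (le_lt_trans tauM1).
have kR : 0 < k%:R :> R by rewrite ltr0n.
pose q := (M %/ k)%N.
(* Indeed [k / tau <= M < (q + 1) k]. *)
have q_lt : tau^-1 - 1 < q%:R.
  rewrite ltrBlDr natr1 -(ltr_pM2r kR) -natrM.
  apply: (@le_lt_trans _ _ M%:R); last by rewrite ltr_nat ltn_ceil.
  by rewrite ler_pdivrMl.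
have tauV : 3 < tau^-1.
  by rewrite -[ltLHS]invrK ltf_pV2// posrE invr_gt0.
have q0 : (0 < q)%N.
  by rewrite -(ltr_nat R) (lt_trans _ q_lt)//; lra.
have hq : ln 2 + 1 < kappa * ln q%:R.
  apply: (lt_le_trans hkappa); rewrite ler_pM2l// ler_ln ?posrE ?ltr0n//; [exact: ltW|lra].
(* The factor [e] in the denominator of the size absorbs the rounding of [tau M] down to [k]. *)
have Nk : N%:R <= expR k%:R :> R.
  apply: (le_trans Nle); rewrite ler_pdivrMr ?mulr_gt0 ?expR_gt0// mulrCA -expRD natr1.
  rewrite -[leLHS]mul1r ler_pM ?expR_ge0 ?ler1n// ler_expR.
  exact: ltW.
have [f fP] := @agreement_code R k q N kappa k0 q0 hq Nk.
pose n := `|Num.ceil (M%:R / gamma)|%N.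
have Mg0 : 0 < M%:R / gamma by rewrite divr_gt0.
have nE : (Num.ceil (M%:R / gamma))%:~R = n%:R :> R.
  by rewrite -[in LHS](@gez0_abs (Num.ceil _))// ceil_ge0 (lt_trans _ Mg0)// oppr_lt0.
have Mn : M%:R <= n%:R * gamma.
  by rewrite -ler_pdivrMr// -nE ceil_ge.
have n0 : (0 < n)%N by rewrite -(ltr_nat R) -nE (lt_le_trans Mg0)// ceil_ge.
set e := info_tail W p C.
have e0 : 0 <= fine e.
  by rewrite fine_ge0// /e info_tailE// expect_ge0// => x; rewrite lee_fin prob_ge0.
have [s [hu hw]] := @random_code R X Y W p C WP pP C0 n a a' n0 a0 a'0 haa'.
set D := decoding_set W p C in hu hw.
set u := fun i => prob (W (s i)) (~` D (s i)).
set w := fun i => \sum_(l | l != i) prob (W (s i)) (D (s l)).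
have ae0 : 0 <= a * fine e by rewrite mulr_ge0// ltW.
have anC0 : 0 <= a' * (n%:R / C) by rewrite !mulr_ge0 ?invr_ge0// ltW.
have u0 i : 0 <= u i by exact: prob_ge0.
have w0 i : 0 <= w i by apply: sumr_ge0 => l _; exact: prob_ge0.
have cu := @markov_card R n u _ b u0 ae0 b0 hu.
have cw := @markov_card R n w _ b' w0 anC0 b'0 hw.
pose G := [set i | (u i <= b * (a * fine e)) && (w i <= b' * (a' * (n%:R / C)))]%SET.
(* At most [n / b] and [n / b'] indices violate the two conditions, leaving at least
   [n gamma >= M]. *)
have MG : (M <= #|G|)%N.
  rewrite -(ler_nat R); apply: (le_trans Mn).
  have : (n <= #|G| + (#|[pred i | (b * (a * fine e) < u i)%R]| +
      #|[pred i | (b' * (a' * (n%:R / C)) < w i)%R]|))%N.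
    rewrite -[leqLHS]card_ord -(cardsC G) leq_add2l -cardUI.
    apply: leq_trans (leq_addr _ _); apply: subset_leq_card; apply/fintype.subsetP => i.
    by rewrite !inE negb_and -!ltNge.
  rewrite -(ler_nat R) !natrD => hn.
  by rewrite /gamma !mulrBr mulr1; lra.
(* The array fits into [G] because [k q <= M]. *)
have [|phi phi_inj phiG] := @injection_into ('I_k * 'I_q)%type _ G.
  by rewrite card_prod !card_ord (leq_trans _ MG)// mulnC leq_trunc_div.
have muE : ((a * b)%:E * e = (b * (a * fine e))%:E)%E.
  by rewrite -[e in LHS]fineK ?info_tail_fin_num// -EFinM; congr EFin; ring.
have KE : K = b' * (a' * (n%:R / C)) by rewrite /K nE; ring.
exists N; eexists; eexists; split; last exact: NE.
rewrite muE KE; apply: (@id_code_of_agreement_code R X Y W WP n k q N s D phi f) => //.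
- by move=> t; have := phiG t; rewrite inE => /andP[].
- by move=> t; have := phiG t; rewrite inE => /andP[].
Qed.
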